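(* Let $L$ be an atomless spatial frame with pointless part $E$ and spatial support $W$. Then $L$ is compact if and only if $W$ is maximal among independent families of proper regular filters on $E$.
   Context: All frames are completely regular. $\max L$ is the set of maximal elements of $L\setminus\{\top\}$. $L$ is spatial if every element is the meet of the maximal elements above it. An element $c$ is a successor of $a$ if $c>a$ and there is no $b$ with $a<b<c$; an atom is a successor of $\bot$. The pointless part of $L$ is the sublocale $E=\pi L=\{a\in L:a\text{ has no successor}\}$. For $a\in\max L$ let $y_a=\{b\in E:b\nleq a\}$; the spatial support of $L$ is $W=\{y_a:a\in\max L\}$. Write $a\prec\!\!\prec b$ for ''$a$ is completely below $b$''. A filter $x$ on a frame is round if for every $a\in x$ there is $b\in x$ with $b\prec\!\!\prec a$; it is regular if it is round and $\bigvee_{b\in x}b^*=\top$ ($b^*$ the pseudocomplement); it is proper if $\bot\notin x$. A family of filters is independent if any two distinct filters of the family contain disjoint elements. Maximality is with respect to inclusion of families. *)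

(* Defs.v *)
From HB Require Import structures.
From mathcomp Require Import all_boot all_order all_algebra.
From mathcomp Require Import boolp classical_sets cardinality.

Set Implicit Arguments.
Unset Strict Implicit.
Unset Printing Implicit Defensive.

Import Order.TTheory.
Local Open Scope classical_set_scope.
Local Open Scope order_scope.

HB.mixin Record isFrame d T of Order.TBDistrLattice d T := {
  joins : set T -> T;
  joins_ub : forall (A : set T) x, A x -> x <= joins A;
  joins_le : forall (A : set T) y, (forall x, A x -> x <= y) -> joins A <= y;
  meet_joins : forall x (A : set T),
    x `&` joins A = joins [set x `&` y | y in A]
}.

#[short(type="frameType")]
HB.structure Definition Frame d := { T of isFrame d T & Order.TBDistrLattice d T }.

(* Finite joins, top and bottom are the ones determined by [joins]. *)
HB.factory Record POrder_isFrame d T of Order.POrder d T := {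
  joins : set T -> T;
  joins_ub : forall (A : set T) x, A x -> x <= joins A;
  joins_le : forall (A : set T) y, (forall x, A x -> x <= y) -> joins A <= y;
  meet : T -> T -> T;
  meetP : forall x y z, (x <= meet y z) = (x <= y) && (x <= z);
  meet_joins_le : forall x (A : set T) y,
    (forall a, A a -> meet x a <= y) -> meet x (joins A) <= y
}.

HB.builders Context d T of POrder_isFrame d T.

Let join (x y : T) := joins [set z | z = x \/ z = y].

Let joinP x y z : (join x y <= z) = (x <= z) && (y <= z).
Proof.
apply/idP/andP => [h|[xz yz]]; last by apply: joins_le => w [->|->].
by split; apply: le_trans h; apply: joins_ub; [left|right].
Qed.

HB.instance Definition _ := @Order.POrder_MeetJoin_isLattice.Build d T
  meet join meetP joinP.

Let meetUl : @left_distributive T T Order.meet Order.join.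
Proof.
move=> x y z; apply/le_anti/andP; split; last first.
  rewrite leUx !lexI !leIr !andbT.
  by rewrite !(le_trans (leIl _ _)) ?leUl ?leUr.
rewrite meetC; apply: meet_joins_le => a.
have meetE u v : meet u v = u `&` v by [].
by case=> ->; rewrite meetE meetC ?leUl ?leUr.
Qed.

HB.instance Definition _ := Order.Lattice_Meet_isDistrLattice.Build d T meetUl.

Let bot_le x : joins set0 <= x. Proof. exact: joins_le. Qed.
Let le_top x : x <= joins setT. Proof. exact: joins_ub. Qed.

HB.instance Definition _ := Order.hasBottom.Build d T bot_le.
HB.instance Definition _ := Order.hasTop.Build d T le_top.

Let meet_joins x (A : set T) :
  x `&` joins A = joins [set x `&` y | y in A].
Proof.
apply/le_anti/andP; split.
  by apply: meet_joins_le => a Aa; apply: joins_ub; exists a.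
apply: joins_le => _ [a Aa <-]; rewrite lexI leIl.
by rewrite (le_trans (leIr _ _)) ?joins_ub.
Qed.

HB.instance Definition _ := isFrame.Build d T joins_ub joins_le meet_joins.
HB.end.

Section FrameTheory.
Context {d : Order.disp_t} {L : frameType d}.
Implicit Types (a b c m : L) (A B : set L).

Definition infs A : L := joins [set x | forall a, A a -> x <= a].

Definition himp a b : L := joins [set x | x `&` a <= b].

Definition pseudocompl a : L := joins [set x | x `&` a = \bot].

Definition rather_below a b := pseudocompl a `|` b = \top.

(* Interpolation by a scale indexed by the rationals of [0, 1]; the values of [c]
   outside [0, 1] are irrelevant. *)
Definition completely_below a b := exists c : rat -> L,
  [/\ c 0%R = a, c 1%R = b &
      forall p q : rat, (0 <= p)%R -> (p < q)%R -> (q <= 1)%R ->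
        rather_below (c p) (c q)].

Definition max_elements : set L :=
  [set m | m < \top /\ forall a, m < a -> a = \top].

Definition successor a c := a < c /\ ~ exists b, a < b < c.

Lemma le_infs A x : (forall a, A a -> x <= a) -> x <= infs A.
Proof. exact: joins_ub. Qed.

Lemma infs_lb A a : A a -> infs A <= a.
Proof. by move=> Aa; apply: joins_le => x; apply. Qed.

Lemma himpP x a b : (x <= himp a b) = (x `&` a <= b).
Proof.
apply/idP/idP => [h|]; last exact: joins_ub.
rewrite (le_trans (leI2 h (lexx a)))// meetC meet_joins.
by apply: joins_le => _ [y + <-]; rewrite meetC.
Qed.

End FrameTheory.

Definition completely_regular d (L : frameType d) :=
  forall a : L, a = joins [set b | completely_below b a].

Definition spatial d (L : frameType d) :=
  forall a : L, a = infs [set m | max_elements m /\ a <= m].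

Definition atomless d (L : frameType d) := ~ exists c : L, successor \bot c.

Definition compact_frame d (L : frameType d) :=
  forall A : set L, joins A = \top ->
    exists B : set L, [/\ finite_set B, B `<=` A & joins B = \top].

Record sublocale d (L : frameType d) := Sublocale {
  sl_set : set L;
  sl_infs : forall A : set L, A `<=` sl_set -> sl_set (infs A);
  sl_himp : forall a s : L, sl_set s -> sl_set (himp a s)
}.

Definition sl_sort d (L : frameType d) (S : sublocale L) : Type :=
  {x : L | x \in sl_set S}.
Coercion sl_sort : sublocale >-> Sortclass.

Section SublocaleFrame.
Context (d : Order.disp_t) (L : frameType d) (S : sublocale L).

HB.instance Definition _ := SubChoice.on (sl_sort S).
HB.instance Definition _ :=
  [SubChoice_isSubPOrder of sl_sort S by <: with d].

Definition sl_lift (x : L) (Sx : sl_set S x) : S := exist _ x (mem_set Sx).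

Fact sl_val (x : S) : sl_set S (val x). Proof. exact: set_mem (valP x). Qed.

Definition sl_uppers (A : set S) : set L :=
  [set u | sl_set S u /\ forall a, A a -> val a <= u].

(* Joins in [S] are least upper bounds within [S], not joins of [L]. *)
Definition sl_joins (A : set S) : S :=
  @sl_lift (infs (sl_uppers A))
    (sl_infs (fun u (Au : sl_uppers A u) => proj1 Au)).

Fact sl_meet_subproof (x y : S) : sl_set S (val x `&` val y).
Proof.
have -> : val x `&` val y = infs [set z | z = val x \/ z = val y].
  apply/le_anti/andP; split.
    by apply: le_infs => _ [->|->]; rewrite ?leIl ?leIr.
  by rewrite lexI; apply/andP; split; apply: infs_lb; [left|right].
by apply: sl_infs => _ [->|->]; exact: sl_val.
Qed.

Definition sl_meet (x y : S) : S := sl_lift (sl_meet_subproof x y).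

Fact sl_joins_ub (A : set S) x : A x -> x <= sl_joins A.
Proof. by move=> Ax; rewrite leEsub/=; apply: le_infs => u [_]; apply. Qed.

Fact sl_joins_le (A : set S) y : (forall x, A x -> x <= y) -> sl_joins A <= y.
Proof.
move=> Ay; rewrite leEsub/=; apply: infs_lb; split; first exact: sl_val.
by move=> a /Ay; rewrite leEsub.
Qed.

Fact sl_meetP x y z : (x <= sl_meet y z) = (x <= y) && (x <= z).
Proof. by rewrite !leEsub/= lexI. Qed.

Fact sl_meet_joins_le x (A : set S) y :
  (forall a, A a -> sl_meet x a <= y) -> sl_meet x (sl_joins A) <= y.
Proof.
move=> Ay; rewrite leEsub/= meetC -himpP; apply: infs_lb; split.
  by apply: sl_himp; exact: sl_val.
by move=> a /Ay; rewrite leEsub/= himpP meetC.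
Qed.

HB.instance Definition _ := POrder_isFrame.Build d (sl_sort S)
  sl_joins_ub sl_joins_le sl_meetP sl_meet_joins_le.

End SublocaleFrame.

Section PointlessPart.
Context (d : Order.disp_t) (L : frameType d).

Definition pointless : set L := [set a | ~ exists c, successor a c].

Fact pointless_between a c : pointless a -> a < c -> exists b, a < b < c.
Proof.
by move=> Ea ac; apply: contrapT => h; apply: Ea; exists c; split.
Qed.

Fact pointless_infs (A : set L) : A `<=` pointless -> pointless (infs A).
Proof.
move=> AE [c [mc nb]].
have [a Aa nca] : exists2 a, A a & ~~ (c <= a).
  apply: contrapT => h; have : c <= infs A.
    apply: le_infs => a Aa; apply: contrapT => /negP nca.
    by apply: h; exists a.
  by move=> cA; have := lt_le_trans mc cA; rewrite ltxx.
have aca : a < c `|` a by rewrite lt_leAnge leUr/= leUx lexx andbT.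
have [b /andP[ab bca]] := pointless_between (AE _ Aa) aca.
have bE : b = (b `&` c) `|` a.
  by rewrite -{1}(meet_idPl (ltW bca)) meetUr (meet_idPr (ltW ab)).
apply: nb; exists (b `&` c); rewrite !lt_neqAle leIr andbT lexI (ltW mc) andbT.
rewrite (le_trans (infs_lb Aa) (ltW ab)) andbT; apply/andP; split.
- apply/eqP => e; move: ab; rewrite bE -e (join_idPr (infs_lb Aa)).
  by rewrite ltxx.
- apply/eqP => e; move: bca; rewrite bE e.
  by rewrite ltxx.
Qed.

Fact pointless_himp (a s : L) : pointless s -> pointless (himp a s).
Proof.
move=> Es [c [mc nb]].
have nca : ~~ (c `&` a <= s) by move: mc; rewrite -himpP lt_leAnge => /andP[].
have sca : s < s `|` (c `&` a).
  by rewrite lt_leAnge leUl/= leUx lexx.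
have [b /andP[sb bca]] := pointless_between Es sca.
have ms : himp a s `&` a <= s by rewrite -himpP.
apply: nb; exists (himp a s `|` (b `&` c)).
rewrite !lt_neqAle leUl leUx leIr (ltW mc) !andbT.
apply/andP; split; apply/eqP => e.
- have bcm : b `&` c <= himp a s by rewrite [leRHS]e leUr.
  move: sb; rewrite lt_leAnge => /andP[_ /negP]; apply.
  rewrite -(meet_idPl (ltW bca)) meetUr leUx leIr/= meetA -himpP.
  exact: bcm.
- move: bca; rewrite lt_leAnge => /andP[_ /negP]; apply.
  rewrite leUx (ltW sb)/= -e meetUl leUx (le_trans ms (ltW sb))/=.
  by rewrite -meetA leIl.
Qed.

Definition pointless_part : sublocale L :=
  Sublocale pointless_infs pointless_himp.

(* For [a] in [max_elements], the filter of those elements of the pointless part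
   that contain the point corresponding to [a]. *)
Definition point_filter (a : L) : set pointless_part :=
  [set b | ~~ (val b <= a)].

Definition spatial_support : set (set pointless_part) :=
  [set point_filter a | a in max_elements].

End PointlessPart.

Arguments spatial_support {d} L.

Section Filters.
Context (d : Order.disp_t) (E : frameType d).
Implicit Types (x y : set E) (V W : set (set E)).

(* Completely below, pseudocomplements and joins are those of [E]; when [E] is a
   sublocale they may differ from those of the ambient frame. *)
Definition frame_filter x :=
  [/\ x \top, (forall a b, x a -> a <= b -> x b) &
      (forall a b, x a -> x b -> x (a `&` b))].

Definition round x := forall a, x a -> exists2 b, x b & completely_below b a.

Definition regular_filter x :=
  [/\ frame_filter x, round x & joins [set pseudocompl b | b in x] = \top].

Definition proper_filter x := ~ x \bot.

Definition independent W := forall x y, W x -> W y -> x <> y ->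
  exists a b, [/\ x a, y b & a `&` b = \bot].

Definition indep_regular_family W :=
  (forall x, W x -> regular_filter x /\ proper_filter x) /\ independent W.

End Filters.

Definition maximal_family T (P : set (set T) -> Prop) (W : set (set T)) :=
  P W /\ forall V, P V -> W `<=` V -> V = W.

(* Main.v *)
Require Import Defs.
From mathcomp Require Import all_boot all_order.
From mathcomp Require Import all_algebra boolp classical_sets cardinality.
From mathcomp Require Import lra.

Set Implicit Arguments.
Unset Strict Implicit.
Unset Printing Implicit Defensive.

Import Order.TTheory.
Local Open Scope classical_set_scope.
Local Open Scope order_scope.

(** Because [L] is atomless, [\bot] lies in the pointless part [E]; as [E] is
    closed under Heyting implication, every pseudocomplement computed in [L]
    lies in [E] as well. Hence [E] has enough elements to separate points of
    [L], and the point filters [y_a] form an independent family of proper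
    regular filters whether or not [L] is compact
    ([spatial_support_indep_regular]). The one delicate point is regularity:
    the join in [E] of the pseudocomplements of members of [y_a] lies above [a]
    by complete regularity, and it cannot be [a], which has the successor
    [\top] and is therefore not in [E].

    If [L] is compact and a proper filter [x] were independent of all [y_a],
    then every point would have a neighbourhood in [E] disjoint from a member
    of [x]; these neighbourhoods cover [L] by spatiality, and intersecting the
    members of [x] that belong to a finite subcover yields [\bot]
    ([compact_meets_point_filter]).

    If [L] is not compact, a cover [A] without finite subcover yields the
    filter [cover_filter A] on [E] generated by the pseudocomplements [c^*],
    where [c] is completely below a finite join of elements of [A]. It is round
    by interpolation, and proper because [c^* = \bot] would turn that finite
    join into [\top]. The pseudocomplements of its members have join [\top]
    already in [L], not only in [E]; this gives its regularity, its
    independence from every [y_a] and its difference from every [y_a], so the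
    spatial support is not maximal. *)

(** * Pseudocomplements and the completely below relation *)

Section Below.
Context {d : Order.disp_t} {L : frameType d}.
Implicit Types (a b c m : L) (A B : set L).

Lemma pseudocomplE a : pseudocompl a = himp a \bot.
Proof.
by congr joins; apply/seteqP; split => x /=; rewrite lex0 => /eqP.
Qed.

Lemma pseudocomplP x a : (x <= pseudocompl a) = (x `&` a == \bot).
Proof. by rewrite pseudocomplE himpP lex0. Qed.

Lemma meet_pseudocompl a : pseudocompl a `&` a = \bot.
Proof. by apply/eqP; rewrite -pseudocomplP. Qed.

Lemma pseudocomplS a b : a <= b -> pseudocompl b <= pseudocompl a.
Proof.
move=> ab; rewrite pseudocomplP -lex0 -(meet_pseudocompl b).
by rewrite leI2.
Qed.

Lemma le_pseudocomplK a : a <= pseudocompl (pseudocompl a).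
Proof. by rewrite pseudocomplP meetC meet_pseudocompl. Qed.

Lemma rather_belowW a b b' : rather_below a b -> b <= b' -> rather_below a b'.
Proof. by move=> ab bb'; apply: le_anti; rewrite lex1 -ab leU2. Qed.

Lemma rather_below_pseudocompl a b :
  rather_below a b -> rather_below (pseudocompl b) (pseudocompl a).
Proof.
move=> ab; apply: le_anti; rewrite lex1 -ab joinC.
by rewrite leU2 // le_pseudocomplK.
Qed.

Lemma rather_belowU a b a' b' : rather_below a b -> rather_below a' b' ->
  rather_below (a `|` a') (b `|` b').
Proof.
move=> ab ab'.
have aa' : pseudocompl a `&` pseudocompl a' <= pseudocompl (a `|` a').
  rewrite pseudocomplP meetUr -lex0 leUx; apply/andP; split.
  - by rewrite -(meet_pseudocompl a) leI2 ?leIl.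
  - by rewrite -(meet_pseudocompl a') leI2 ?leIr.
apply: le_anti; rewrite lex1 /=; apply: le_trans (leU2 aa' (lexx _)).
rewrite joinIl lexI joinA ab join1x lexx /=.
by rewrite joinCA ab' joinx1.
Qed.

Lemma completely_below_rather a b : completely_below a b -> rather_below a b.
Proof. by case=> c [<- <-]; apply. Qed.

(** Replacing the value at [1] of a scale from [a] to [b] by [b'] gives a scale
    from [a] to [b']. *)
Lemma completely_belowW a b b' :
  completely_below a b -> b <= b' -> completely_below a b'.
Proof.
case=> c [c0 c1 cP] bb'.
exists (fun p => if p == 1%R then b' else c p); split => //= p q p0 pq q1.
have /negPf -> : p != 1%R by rewrite lt_eqF // (lt_le_trans pq).
case: eqP => [qE|_]; last exact: cP.
by apply: rather_belowW bb'; rewrite -c1; apply: cP; rewrite // -qE.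
Qed.

Lemma completely_belowU a b a' b' :
  completely_below a b -> completely_below a' b' ->
  completely_below (a `|` a') (b `|` b').
Proof.
move=> [c [<- <- cP]] [c' [<- <- cP']].
exists (fun p => c p `|` c' p); split => // p q p0 pq q1.
by apply: rather_belowU; [exact: cP|exact: cP'].
Qed.

Lemma completely_below_pseudocompl a b : completely_below a b ->
  completely_below (pseudocompl b) (pseudocompl a).
Proof.
move=> [c [<- <- cP]]; exists (fun p => pseudocompl (c (1 - p)%R)).
split; rewrite ?GRing.subr0 ?GRing.subrr // => p q p0 pq q1.
by apply: rather_below_pseudocompl; apply: cP; lra.
Qed.

Lemma completely_below_interpolate a b : completely_below a b ->
  exists2 e, completely_below a e & completely_below e b.
Proof.
move=> [c [<- <- cP]]; exists (c (1 / 2)%R).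
- exists (fun p => c (p / 2)%R); split; rewrite ?GRing.mul0r // => p q *.
  by apply: cP; lra.
- exists (fun p => c ((1 + p) / 2)%R); split.
  + by rewrite GRing.addr0.
  + by congr c; lra.
  + by move=> p q *; apply: cP; lra.
Qed.

Lemma completely_regular_nle (L_cr : completely_regular L) a b :
  ~~ (b <= a) -> exists2 c, completely_below c b & ~~ (c <= a).
Proof.
move=> nba; apply: contrapT => h; move/negP: nba; apply.
rewrite (L_cr b); apply: Defs.joins_le => c cb.
by apply: contrapT => /negP nca; apply: h; exists c.
Qed.

Lemma max_join m a : max_elements m -> ~~ (a <= m) -> m `|` a = \top.
Proof. by move=> [_ mP] am; apply: mP; rewrite lt_leAnge leUl leUx lexx. Qed.

Lemma max_meet m a b :
  max_elements m -> ~~ (a <= m) -> ~~ (b <= m) -> ~~ (a `&` b <= m).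
Proof.
move=> mM am bm; apply/negP => /join_idPl.
rewrite joinIr !max_join // meetx1 => m1.
by case: mM; rewrite -m1 ltxx.
Qed.

Lemma max_rather_below m c b : max_elements m ->
  rather_below c b -> b <= m -> ~~ (pseudocompl c <= m).
Proof.
move=> [m1 _] cb bm; apply/negP => cm; move: m1.
by rewrite lt_leAnge -cb leUx cm bm andbF.
Qed.

Lemma spatial_top (L_spatial : spatial L) a :
  (forall m, max_elements m -> ~~ (a <= m)) -> a = \top.
Proof.
move=> aP; apply: le_anti; rewrite lex1 (L_spatial a) /=.
by apply: le_infs => m [/aP/negP].
Qed.

End Below.

(** * Pseudocomplements and reflection in the pointless part *)

Section Pointless.
Context {d : Order.disp_t} {L : frameType d}.
Hypothesis L_atomless : atomless L.
Implicit Types (a c m : L) (A : set L).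

Local Notation E := (pointless_part L).
Implicit Types (b p q : E) (x : set E).

Lemma le_valE p q : (p <= q) = (val p <= val q).
Proof. by rewrite leEsub. Qed.

Lemma pointless_bot : pointless (\bot : L).
Proof. exact: L_atomless. Qed.

Lemma val_bot : val (\bot : E) = \bot.
Proof.
apply: le_anti; rewrite le0x andbT.
by have := le0x (sl_lift (S := E) pointless_bot); rewrite le_valE.
Qed.

Lemma eq_top b : val b = \top -> b = \top.
Proof. by move=> b1; apply: le_anti; rewrite lex1 le_valE b1 lex1. Qed.

Lemma val_meet p q : val (p `&` q) = val p `&` val q.
Proof. by []. Qed.

Lemma meet_eq_bot p q : (p `&` q = \bot) <-> (val p `&` val q = \bot).
Proof.
split=> [pq|pq]; first by rewrite -val_meet pq val_bot.
by apply: val_inj; rewrite val_meet val_bot.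
Qed.

Lemma pointless_pseudocompl a : pointless (pseudocompl a).
Proof. by rewrite pseudocomplE; apply: pointless_himp pointless_bot. Qed.
Arguments pointless_pseudocompl : clear implicits.

Definition pcE a : E := sl_lift (S := E) (pointless_pseudocompl a).

Lemma val_pcE a : val (pcE a) = pseudocompl a.
Proof. by []. Qed.

Lemma val_pseudocompl p : val (pseudocompl p) = pseudocompl (val p).
Proof.
have -> : pseudocompl p = pcE (val p) => //.
apply: le_anti; apply/andP; split.
- by rewrite le_valE pseudocomplP; apply/eqP/meet_eq_bot; exact: meet_pseudocompl.
- by rewrite pseudocomplP; apply/eqP/meet_eq_bot; exact: meet_pseudocompl.
Qed.

Fact pointless_reflect a : pointless (infs [set u | pointless u /\ a <= u]).
Proof. by apply: pointless_infs => u []. Qed.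

Definition reflE a : E := sl_lift (S := E) (@pointless_reflect a).

Lemma le_reflE a : a <= val (reflE a).
Proof. by apply: le_infs => u []. Qed.

Lemma reflE_le a p : (reflE a <= p) = (a <= val p).
Proof.
apply/idP/idP => [|ap]; first by rewrite le_valE; apply: le_trans (le_reflE a).
by rewrite le_valE; apply: infs_lb; split => //; exact: (sl_val p).
Qed.

Lemma reflE_val p : reflE (val p) = p.
Proof. by apply: le_anti; rewrite reflE_le lexx le_valE le_reflE. Qed.

(** Reflecting does not change pseudocomplements, since [a] and its reflection
    lie below the same pseudocomplements, and joins in [E] lie above joins in
    [L]. *)
Lemma rather_below_reflE a c :
  rather_below a c -> rather_below (reflE a) (reflE c).
Proof.
move=> ac; apply: eq_top; apply/eqP; rewrite -le1x -ac leUx.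
have le_l : pcE a <= pseudocompl (reflE a).
  rewrite le_valE val_pseudocompl pseudocomplP meetC -pseudocomplP.
  by rewrite -val_pcE -le_valE reflE_le le_pseudocomplK.
have := le_trans le_l (leUl _ (reflE c)); rewrite le_valE => ->.
by rewrite -reflE_le leUr.
Qed.

Lemma completely_below_reflE a c :
  completely_below a c -> completely_below (reflE a) (reflE c).
Proof.
move=> [f [<- <- fP]]; exists (reflE \o f); split => // p q *.
by apply: rather_below_reflE; exact: fP.
Qed.

Lemma val_top : val (\top : E) = \top.
Proof. by apply: le_anti; rewrite lex1 -reflE_le lex1. Qed.

(** * The point filters *)

Section PointFilters.
Hypothesis L_cr : completely_regular L.

Lemma point_filterE m p : point_filter m p = ~~ (val p <= m).
Proof. by []. Qed.

Lemma point_filter_filter m : max_elements m -> frame_filter (point_filter m).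
Proof.
move=> mM; split.
- by case: mM => + _; rewrite point_filterE val_top lt_leAnge => /andP[].
- move=> p q; rewrite point_filterE le_valE => pm pq.
  by apply: contra pm; exact: le_trans.
- by move=> p q pm qm; apply: max_meet.
Qed.

Lemma point_filter_proper m : proper_filter (point_filter m).
Proof. by rewrite /proper_filter point_filterE val_bot le0x. Qed.

(** Complete regularity of [L] supplies a witness in [L]; reflecting it moves it
    into [E] and only enlarges it. *)
Lemma point_filter_round m : round (point_filter m).
Proof.
move=> b /(completely_regular_nle L_cr)[c cb ncm]; exists (reflE c).
- by apply: contra ncm; apply: le_trans; exact: le_reflE.
- by rewrite -[b]reflE_val; exact: completely_below_reflE.
Qed.

(** If [c] is completely below [m], then [c^*] belongs to the point filter, so
    [c <= c^**] lies below the join in question. By complete regularity that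
    join lies above [m]; it differs from [m], which has the successor [\top],
    so maximality makes it [\top]. *)
Lemma point_filter_joins m : max_elements m ->
  joins [set pseudocompl b | b in point_filter m] = \top.
Proof.
move=> mM; have [m1 mP] := mM; set u := joins _; apply: eq_top.
have mu : m <= val u.
  rewrite (L_cr m); apply: Defs.joins_le => c cm.
  apply: le_trans (le_pseudocomplK c) _.
  rewrite -[pseudocompl c]val_pcE -val_pseudocompl -le_valE.
  apply: Defs.joins_ub; exists (pcE c) => //.
  exact: max_rather_below mM (completely_below_rather cm) (lexx _).
apply: (mP); rewrite lt_neqAle mu andbT; apply/eqP => mE.
apply: (sl_val u); exists \top; rewrite -mE; split => // -[b /andP[mb b1]].
by move: b1; rewrite (mP _ mb) ltxx.
Qed.

(** Some [c] completely below [n] does not lie below [m]; the pseudocomplements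
    [c^**] and [c^*] then separate the two points inside [E]. *)
Lemma point_filter_independent : independent (spatial_support L).
Proof.
move=> _ _ [m mM <-] [n nM <-] mn.
have nm : ~~ (n <= m).
  apply: contra_notN mn; rewrite le_eqVlt => /orP[/eqP -> //|nm].
  by case: nM => _ /(_ _ nm) m1; case: mM; rewrite m1 ltxx.
have [c cn cm] := completely_regular_nle L_cr nm.
exists (pcE (pseudocompl c)), (pcE c); split.
- by apply: contra cm; apply: le_trans; exact: le_pseudocomplK.
- exact: max_rather_below nM (completely_below_rather cn) (lexx _).
- by apply/meet_eq_bot; exact: meet_pseudocompl.
Qed.

Lemma spatial_support_indep_regular : indep_regular_family (spatial_support L).
Proof.
split; last exact: point_filter_independent.
move=> _ [m mM <-]; split; last exact: point_filter_proper.
split; [exact: point_filter_filter|exact: point_filter_round|].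
exact: point_filter_joins.
Qed.

End PointFilters.

(** * Compactness forces maximality *)

(** Each [a] in [B] is disjoint from its own member of [x]; the meet of these
    finitely many members serves all of [B] at once. *)
Lemma filter_disjoint_finite x (B : set L) : frame_filter x -> finite_set B ->
  (forall a, B a -> exists2 p, x p & val p `&` a = \bot) ->
  exists2 p, x p & forall a, B a -> val p `&` a = \bot.
Proof.
move=> [x1 xle xI] /finite_seqP[s ->].
elim: s => [|a s IHs] sP; first by exists \top.
have [b bs|p xp pP] := IHs; first by apply: sP; rewrite /= inE bs orbT.
have [q xq qP] := sP a (mem_head _ _).
exists (p `&` q); first exact: xI.
move=> b; rewrite val_meet /= inE => /orP[/eqP ->|/pP pb].
- by rewrite -meetA qP meetx0.
- by rewrite meetAC pb meet0x.
Qed.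

(** Otherwise the elements of [E] disjoint from some member of [x] would lie
    jointly below no maximal element, hence cover [L] by spatiality. *)
Lemma compact_meets_point_filter x :
  spatial L -> compact_frame L -> frame_filter x -> proper_filter x ->
  exists2 m, max_elements m &
    forall p q, x p -> point_filter m q -> p `&` q <> \bot.
Proof.
move=> L_spatial L_compact xF xproper; apply: contrapT => h.
pose A : set L :=
  [set val q | q in [set q : E | exists2 p : E, x p & val p `&` val q = \bot]].
have A1 : joins A = \top.
  apply: (spatial_top L_spatial) => m mM; apply/negP => Am; apply: h.
  exists m => // p q xp qm /meet_eq_bot pq; move/negP: qm; apply.
  by apply: le_trans Am; apply: Defs.joins_ub; exists q => //; exists p.
have [B [finB BA B1]] := L_compact A A1.
have [|p xp pB] := filter_disjoint_finite xF finB.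
  by move=> _ /BA[q [p xp pq] <-]; exists p.
suff p0 : p = \bot by apply: xproper; rewrite -p0.
apply: val_inj; apply: le_anti; rewrite val_bot le0x andbT.
rewrite -[val p]meetx1 -B1 meet_joins.
by apply: Defs.joins_le => _ [a Ba <-]; rewrite pB.
Qed.

(** * Noncompactness gives a further filter *)

Section CoverFilter.
Variable A : set L.

Definition below_finite_join c := exists B : set L,
  [/\ finite_set B, B `<=` A & completely_below c (joins B)].

(** Requiring [c] to be completely below a finite join, instead of equal to one,
    leaves room for interpolation and so makes the filter round. *)
Definition cover_filter : set E :=
  [set b | exists2 c, below_finite_join c & pseudocompl c <= val b].

Lemma below_finite_join_bot : below_finite_join \bot.
Proof.
exists set0; split => //; apply: completely_belowW (le0x _).
exists (fun=> \bot); split => // _ _ _ _ _; apply: le_anti.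
by rewrite lex1 joinx0 pseudocomplP meetx0 eqxx.
Qed.

Lemma below_finite_joinU a c :
  below_finite_join a -> below_finite_join c -> below_finite_join (a `|` c).
Proof.
move=> [B [finB BA aB]] [C [finC CA cC]]; exists (B `|` C)%classic; split.
- by rewrite finite_setU.
- by move=> e [/BA|/CA].
- apply: completely_belowW (completely_belowU aB cC) _.
  rewrite leUx; apply/andP; split; apply: Defs.joins_le => e eP.
  + by apply: Defs.joins_ub; left.
  + by apply: Defs.joins_ub; right.
Qed.

Lemma below_finite_join_interpolate c : below_finite_join c ->
  exists2 e, below_finite_join e & completely_below c e.
Proof.
move=> [B [finB BA /completely_below_interpolate[e ce eB]]].
by exists e => //; exists B.
Qed.

Lemma cover_filter_pcE c : below_finite_join c -> cover_filter (pcE c).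
Proof. by move=> Ac; exists c. Qed.

Lemma cover_filter_filter : frame_filter cover_filter.
Proof.
split.
- by exists \bot; [exact: below_finite_join_bot|rewrite val_top lex1].
- move=> p q [c Ac cp]; rewrite le_valE => pq.
  by exists c => //; exact: le_trans pq.
- move=> p q [a Aa ap] [c Ac cq]; exists (a `|` c).
    exact: below_finite_joinU.
  rewrite val_meet lexI (le_trans _ ap) ?(le_trans _ cq) //.
  + by rewrite pseudocomplS ?leUr.
  + by rewrite pseudocomplS ?leUl.
Qed.

Lemma cover_filter_round : round cover_filter.
Proof.
move=> p [c Ac cp]; have [e Ae ce] := below_finite_join_interpolate Ac.
exists (pcE e); first exact: cover_filter_pcE.
rewrite -[pcE e]reflE_val -[p]reflE_val; apply: completely_below_reflE.
exact: completely_belowW (completely_below_pseudocompl ce) cp.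
Qed.

Lemma cover_filter_proper :
  (forall B, finite_set B -> B `<=` A -> joins B <> \top) ->
  proper_filter cover_filter.
Proof.
move=> noB [c [B [finB BA cB]]]; rewrite val_bot lex0 => /eqP c0.
apply: (noB B finB BA); rewrite -(completely_below_rather cB) c0.
by rewrite join0x.
Qed.

Hypothesis L_cr : completely_regular L.
Hypothesis A1 : joins A = \top.

(** Every [c] completely below a member of [A] lies below [c^**], and these [c]
    cover [L] by complete regularity. *)
Lemma cover_filter_joins :
  joins [set pseudocompl (val b) | b in cover_filter] = \top.
Proof.
apply: le_anti; rewrite lex1 -A1 /=; apply: Defs.joins_le => a Aa.
rewrite [leLHS]L_cr; apply: Defs.joins_le => c ca.
apply: le_trans (le_pseudocomplK c) _; apply: Defs.joins_ub.
exists (pcE c) => //; apply: cover_filter_pcE; exists [set a]; split => //.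
- by move=> _ ->.
- by apply: completely_belowW ca _; apply: Defs.joins_ub.
Qed.

Lemma cover_filter_regular : regular_filter cover_filter.
Proof.
split; [exact: cover_filter_filter|exact: cover_filter_round|].
(* joins of [L] lie below the corresponding joins of [E] *)
apply: eq_top; apply/eqP; rewrite -le1x -cover_filter_joins.
apply: Defs.joins_le => _ [b xb <-]; rewrite -val_pseudocompl -le_valE.
by apply: Defs.joins_ub; exists b.
Qed.

(** A maximal element cannot lie above the pseudocomplements of all members of
    the cover filter, as these have join [\top] in [L]. *)
Lemma cover_filter_disjoint m : max_elements m ->
  exists2 p, cover_filter p & point_filter m (pseudocompl p).
Proof.
move=> [m1 _]; apply: contrapT => h; move: m1.
rewrite lt_leAnge => /andP[_ /negP]; apply.
rewrite -cover_filter_joins; apply: Defs.joins_le => _ [p xp <-].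
apply: contrapT => /negP pm; apply: h; exists p => //.
by rewrite point_filterE val_pseudocompl.
Qed.

Lemma cover_filter_notin : ~ spatial_support L cover_filter.
Proof.
move=> [m mM mE]; have [p xp pm] := cover_filter_disjoint mM.
rewrite -mE in xp; have [_ _ mI] := point_filter_filter mM.
apply: (@point_filter_proper m).
by rewrite -(meet_pseudocompl p); exact: mI.
Qed.

Lemma cover_filter_extends :
  (forall B, finite_set B -> B `<=` A -> joins B <> \top) ->
  indep_regular_family (cover_filter |` spatial_support L).
Proof.
move=> noB; have [suppP indep] := spatial_support_indep_regular L_cr.
split=> [x [->|/suppP//]|x y].
  by split; [exact: cover_filter_regular|exact: cover_filter_proper].
move=> [->|Wx] [->|Wy] // xy; last exact: indep.
- have [m mM <-] := Wy; have [p xp pm] := cover_filter_disjoint mM.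
  by exists p, (pseudocompl p); rewrite meetC meet_pseudocompl.
- have [m mM <-] := Wx; have [p xp pm] := cover_filter_disjoint mM.
  by exists (pseudocompl p), p; rewrite meet_pseudocompl.
Qed.

End CoverFilter.
End Pointless.

(** * Compactness and maximality *)

Theorem proposition7p1p4 (d : Order.disp_t) (L : frameType d)
    (L_cr : completely_regular L) (L_atomless : atomless L)
    (L_spatial : spatial L) :
  compact_frame L <->
  maximal_family (@indep_regular_family _ (pointless_part L))
    (spatial_support L).
Proof.
split=> [L_compact|[_ maxW] A A1].
- split; first exact: spatial_support_indep_regular.
  move=> V [VP Vindep] WV; apply/seteqP; split => // x Vx.
  have [[xF _ _] xproper] := VP x Vx.
  have [m mM xm] :=
    compact_meets_point_filter L_atomless L_spatial L_compact xF xproper.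
  exists m => //; apply: contrapT => mx.
  have [q [p [qm xp qp]]] : exists q p : pointless_part L,
      [/\ point_filter m q, x p & q `&` p = \bot].
    by apply: Vindep => //; apply: WV; exists m.
  by apply: (xm p q xp qm); rewrite meetC.
- apply: contrapT => noB.
  apply: (cover_filter_notin L_atomless L_cr A1).
  rewrite -(maxW (cover_filter A |` spatial_support L)); first by left.
  + apply: cover_filter_extends => // B finB BA B1.
    by apply: noB; exists B.
  + by move=> x; right.
Qed.
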